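(* Let $X$ be a continuum. Then $X$ is semi-Kelley if and only if for every $a,b\in X$ and every $I\in C(X)$ irreducible between $a$ and $b$, at least one of the following two conditions holds: (i) for every sequence $\{a_n\}_{n=1}^\infty$ in $X$ converging to $a$ there exists a sequence $\{A_n\}_{n=1}^\infty$ in $C(X)$ converging to $I$ such that $a_n\in A_n$ for each $n\in\mathbb N$; or (ii) for every sequence $\{b_n\}_{n=1}^\infty$ in $X$ converging to $b$ there exists a sequence $\{B_n\}_{n=1}^\infty$ in $C(X)$ converging to $I$ such that $b_n\in B_n$ for each $n\in\mathbb N$.
   Context: A continuum is a compact connected metric space with more than one point. A subcontinuum of a continuum $X$ is a non-empty compact connected subset of $X$ (one-point sets are allowed). $C(X)$ denotes the hyperspace of all subcontinua of $X$ with the Hausdorff metric; convergence of subcontinua is with respect to this metric. For $I\in C(X)$ and points $a,b$, $I$ is irreducible between $a$ and $b$ if $a,b\in I$ and no proper subcontinuum of $I$ contains both $a$ and $b$. Let $K$ be a subcontinuum of $X$. A maximal limit continuum of $K$ is a subcontinuum $M\subset K$ for which there is a sequence $\{M_n\}_{n=1}^\infty$ of subcontinua of $X$ converging to $M$ such that for each convergent sequence $\{M_n'\}_{n=1}^\infty$ of subcontinua of $X$ with $M_n\subset M_n'$ for each $n\in\mathbb N$ and $\lim M_n'=M'\subset K$, we have $M'=M$. A continuum $X$ is semi-Kelley if for each subcontinuum $K$ of $X$ and every two maximal limit continua $L$ and $M$ of $K$, either $L\subset M$ or $M\subset L$. *)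

(* Defs.v *)
From HB Require Import structures.
From mathcomp Require Import all_boot all_order all_algebra.
From mathcomp Require Import all_classical all_reals all_analysis.

Set Implicit Arguments.
Unset Strict Implicit.
Unset Printing Implicit Defensive.
Import Order.TTheory GRing.Theory Num.Theory.

Local Open Scope classical_set_scope.
Local Open Scope ring_scope.

Definition continuum (R : realType) (X : metricType R) : Prop :=
  [/\ compact [set: X], connected [set: X] & exists x y : X, x <> y].

(* Unlike a continuum, a subcontinuum may be a single point. *)
Definition subcontinuum (R : realType) (X : metricType R) (K : set X) : Prop :=
  [/\ K !=set0, compact K & connected K].

(* C(X); the isMetric instance below equips it with the Hausdorff metric. *)
Record hyperspace (R : realType) (X : metricType R) := Hyperspace {
  hyperspace_set :> set X ;
  hyperspaceP : subcontinuum hyperspace_set }.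

Section hausdorff_distance.
Context {R : realType} {X : metricType R}.
Implicit Types (A B C : set X) (e r : R).

Definition thickening A r : set X := \bigcup_(x in A) ball x r.

Definition hausdorff_radii A B : set R :=
  [set r | [/\ 0 < r, A `<=` thickening B r & B `<=` thickening A r]].

(* inf of an empty or unbounded-below set of reals is 0 by convention; for
   subcontinua this never occurs (hausdorff_radii_neq0, hausdorff_radii_lbound),
   so this is the usual Hausdorff distance. *)
Definition hausdorff_dist A B : R := inf (hausdorff_radii A B).

Lemma hausdorff_radii_sym A B : hausdorff_radii A B = hausdorff_radii B A.
Proof. by apply/seteqP; split => r []. Qed.

Lemma thickeningD A B C r s : A `<=` thickening B r -> B `<=` thickening C s ->
  A `<=` thickening C (r + s).
Proof.
move=> AB BC x /AB[y /BC[z Cz yz] xy]; exists z => //.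
by rewrite addrC; exact: ball_triangle yz xy.
Qed.

Lemma compact_ball A (a : X) : compact A -> \forall r \near +oo, A `<=` ball a r.
Proof.
move=> /compact_near_coveringP cA.
apply: (cA R (pinfty_nbhs R) (fun r x => ball a r x)) => x _.
exists (ball x 1, [set r | mdist a x + 1 < r]).
  split; first exact: nbhsx_ballx.
  by exists (mdist a x + 1); split => //; exact: num_real.
move=> [y r] [] /=; rewrite !ballEmdist/= => xy ar.
apply: le_lt_trans (metric_triangle a x y) _.
by apply: lt_trans ar; rewrite ltrD2l.
Qed.

Lemma hausdorff_radii_neq0 A B : subcontinuum A -> subcontinuum B ->
  hausdorff_radii A B !=set0.
Proof.
move=> [[a Aa] cA _] [[b Bb] cB _].
have [r [r0 Ar Br]] : exists r, [/\ 0 < r, A `<=` ball b r & B `<=` ball a r].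
  near (pinfty_nbhs R) => r; exists r; split; near: r.
  - exact: nbhs_pinfty_gt.
  - exact: compact_ball.
  - exact: compact_ball.
by exists r; split=> // x; [move=> /Ar|move=> /Br] => ?; [exists b|exists a].
Unshelve. all: by end_near. Qed.

Lemma hausdorff_radii_lbound A B : lbound (hausdorff_radii A B) 0.
Proof. by move=> r [/ltW]. Qed.

Lemma hausdorff_dist_ge0 A B : subcontinuum A -> subcontinuum B ->
  0 <= hausdorff_dist A B.
Proof.
move=> sA sB; apply: lb_le_inf; first exact: hausdorff_radii_neq0.
exact: hausdorff_radii_lbound.
Qed.

Lemma hausdorff_dist_le A B r : hausdorff_radii A B r -> hausdorff_dist A B <= r.
Proof. by apply: ge_inf; exists 0; exact: hausdorff_radii_lbound. Qed.

Lemma hausdorff_dist_lt A B r : subcontinuum A -> subcontinuum B ->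
  hausdorff_dist A B < r -> hausdorff_radii A B r.
Proof.
move=> sA sB ABr.
have [s [s0 AB BA] sr] := inf_lt (hausdorff_radii_neq0 sA sB) ABr.
have sub D : thickening D s `<=` thickening D r.
  by move=> x [y Dy xy]; exists y => //; exact: le_ball (ltW sr) _ xy.
split; first exact: lt_trans sr.
- exact: subset_trans AB (sub _).
- exact: subset_trans BA (sub _).
Qed.

Lemma hausdorff_distxx A : subcontinuum A -> hausdorff_dist A A = 0.
Proof.
move=> sA; apply/eqP; rewrite eq_le hausdorff_dist_ge0// andbT.
apply/ler_addgt0Pl => e e0; rewrite addr0; apply: hausdorff_dist_le.
by split => // x Ax; exists x => //; exact: ballxx.
Qed.

Lemma hausdorff_dist0_sub A B : subcontinuum A -> subcontinuum B ->
  hausdorff_dist A B = 0 -> A `<=` B.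
Proof.
move=> sA sB AB0 x Ax; have [_ cB _] := sB.
have /closure_id -> : closed B by apply: compact_closed => //; exact: metric_hausdorff.
move=> U /nbhs_ballP[e e0 xU].
have [_ /(_ x Ax)[y By yx] _] : hausdorff_radii A B e.
  by apply: hausdorff_dist_lt => //; rewrite AB0.
by exists y; split => //; apply: xU; exact: ball_sym.
Qed.

Lemma hausdorff_dist_triangle B A C :
  subcontinuum A -> subcontinuum B -> subcontinuum C ->
  hausdorff_dist A C <= hausdorff_dist A B + hausdorff_dist B C.
Proof.
move=> sA sB sC; apply/ler_addgt0Pl => e e0.
have e20 : 0 < e / 2 by rewrite divr_gt0.
have [r0 AB BA] : hausdorff_radii A B (hausdorff_dist A B + e / 2).
  by apply: hausdorff_dist_lt; rewrite // ltrDl.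
have [s0 BC CB] : hausdorff_radii B C (hausdorff_dist B C + e / 2).
  by apply: hausdorff_dist_lt; rewrite // ltrDl.
have -> : e + (hausdorff_dist A B + hausdorff_dist B C) =
    (hausdorff_dist A B + e / 2) + (hausdorff_dist B C + e / 2).
  by rewrite [RHS]addrACA -splitr addrC.
apply: hausdorff_dist_le; split; first exact: addr_gt0.
- exact: thickeningD AB BC.
- by rewrite addrC; exact: thickeningD CB BA.
Qed.

End hausdorff_distance.

Section hyperspace_metric.
Context {R : realType} {X : metricType R}.
Implicit Types A B C : hyperspace X.

HB.instance Definition _ := gen_eqMixin (hyperspace X).
HB.instance Definition _ := gen_choiceMixin (hyperspace X).

Lemma hyperspace_inj A B : A = B :> set X -> A = B.
Proof.
by case: A B => [A sA] [B sB]/= AB; case: _ / AB in sB *; congr Hyperspace.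
Qed.

Definition hyperspace_mdist A B : R := hausdorff_dist A B.

Let mdistxx A : hyperspace_mdist A A = 0.
Proof. exact: hausdorff_distxx (hyperspaceP A). Qed.

Let mdistC A B : hyperspace_mdist A B = hyperspace_mdist B A.
Proof. by rewrite /hyperspace_mdist /hausdorff_dist hausdorff_radii_sym. Qed.

Let mdist0 A B : hyperspace_mdist A B = 0 -> A = B.
Proof.
move=> AB0; apply: hyperspace_inj; apply/seteqP.
by split; apply: hausdorff_dist0_sub (hyperspaceP _) (hyperspaceP _) _ => //;
  rewrite -/(hyperspace_mdist _ _) mdistC.
Qed.

Let mdistD B A C :
  hyperspace_mdist A C <= hyperspace_mdist A B + hyperspace_mdist B C.
Proof. by apply: hausdorff_dist_triangle; exact: hyperspaceP. Qed.

HB.instance Definition _ :=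
  isMetric.Build R (hyperspace X) mdistxx mdist0 mdistC mdistD.

End hyperspace_metric.

Section continua.
Context {R : realType} (X : metricType R).

Definition irreducible_between (I : hyperspace X) (a b : X) : Prop :=
  [/\ (I : set X) a, (I : set X) b &
      ~ exists J : hyperspace X, [/\ J `<` I, (J : set X) a & (J : set X) b]].

Definition maximal_limit_continuum (K M : hyperspace X) : Prop :=
  M `<=` K /\
  exists2 M_ : nat -> hyperspace X, M_ @ \oo --> M &
    forall (N_ : nat -> hyperspace X) (N : hyperspace X),
      (forall n, M_ n `<=` N_ n) -> N_ @ \oo --> N -> N `<=` K -> N = M.

Definition semi_Kelley : Prop :=
  forall K L M : hyperspace X,
    maximal_limit_continuum K L -> maximal_limit_continuum K M ->
    L `<=` M \/ M `<=` L.

End continua.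

(* Main.v *)
(* Left to right: if (i) fails at [a] there are points arbitrarily close to [a]
   through which no continuum is close to [I].  Among the subcontinua of [I] that
   are limits of continua through such points, a maximal one (Zorn) is a maximal
   limit continuum of [I], contains [a] and differs from [I]; likewise at [b].
   When the two are comparable, the larger one contains [a] and [b], which
   contradicts irreducibility.
   Right to left: given maximal limit continua [L] and [M] of [K] with
   [a] in [L \ M] and [b] in [M \ L], let [I] in [K] be irreducible between [a]
   and [b].  If (i) holds and [L_n --> L], pick [a_n] in [L_n] tending to [a] and
   [A_n --> I] through [a_n]; the continua [L_n U A_n] tend to [L U I], so [I] is
   contained in [L] by maximality and [b] is in [L]. *)
Require Import Defs.
From HB Require Import structures.
From mathcomp Require Import all_boot all_order all_algebra.
From mathcomp Require Import all_classical all_reals all_analysis.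
Local Open Scope classical_set_scope.
Local Open Scope ring_scope.

Set Implicit Arguments.
Unset Strict Implicit.
Unset Printing Implicit Defensive.
Import Order.TTheory GRing.Theory Num.Theory.
Import metricType_numDomainType.

(** [ZL_preorder] on the subtype of [P]. Bounds are asked for non-empty chains only, since [p]
    bounds the empty one. *)
Lemma Zorn_in (T : Type) (R : T -> T -> Prop) (P : set T) :
  (forall t, R t t) -> (forall r s t, R r s -> R s t -> R r t) -> P !=set0 ->
  (forall F, F !=set0 -> F `<=` P -> total_on F R ->
    exists2 b, P b & forall s, F s -> R s b) ->
  exists2 m, P m & forall s, P s -> R m s -> R s m.
Proof.
move=> Rxx Rtr [p Pp] ub.
pose S (x y : {x | P x}) := `[< R (sval x) (sval y) >].
have [|||[m Pm] max] := @ZL_preorder {x | P x} (exist _ p Pp) S.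
- by move=> t; apply/asboolP.
- by move=> r s t /asboolP rs /asboolP st; apply/asboolP; exact: Rtr st.
- move=> A totA; have [[[x Px] Ax]|A0] := pselect (A !=set0); last first.
    by exists (exist _ p Pp) => s As; case: A0; exists s.
  have [|||b Pb bub] := ub [set sval x | x in A].
  + by exists x, (exist _ x Px).
  + by move=> _ [[y Py] _ <-].
  + move=> _ _ [y Ay <-] [z Az <-].
    by have [/asboolP|/asboolP] := totA _ _ Ay Az; [left|right].
  + by exists (exist _ b Pb) => s As; apply/asboolP/bub; exists s.
- exists m => // s Ps ms.
  exact/asboolP/(max (exist _ s Ps))/asboolP.
Qed.

(** * Chains of sets in a compact space *)

Section compact_chains.
Context {T : topologicalType}.
Implicit Types (A B O : set T) (F : set (set T)).

(** The upper tails of the chain generate a filter [G]; along it, compactness turns the local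
    inclusions around each point of [A] into a single one. *)
Lemma compact_chain_cover A F : compact A -> F !=set0 -> total_on F subset ->
  (forall x, A x -> exists2 B, F B & nbhs x B) -> exists2 B, F B & A `<=` B.
Proof.
move=> /compact_near_coveringP cA [B0 FB0] totF cov.
pose G : set_system (set T) :=
  filter_from F (fun B => [set C | F C /\ B `<=` C]).
have GF : ProperFilter G.
  apply: filter_from_proper; last by move=> B FB; exists B; split.
  apply: filter_from_filter; first by exists B0.
  move=> B C FB FC; have [BC|CB] := totF _ _ FB FC.
    by exists C => // D [FD CD]; do !split => //; exact: subset_trans CD.
  by exists B => // D [FD BD]; do !split => //; exact: subset_trans BD.
have GA : \forall B \near G, A `<=` B.
  apply: (cA _ G (fun B x => B x)) => x /cov[B FB xB].
  exists (B, [set C | F C /\ B `<=` C]); first by split => //; exists B.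
  by move=> [y C] [/= By [_ BC]]; exact: BC.
have GFF : \forall B \near G, F B by exists B0 => // B [].
have [B [AB FB]] := filter_ex (filterI GA GFF).
by exists B.
Qed.

(** The complements of the members form an open chain covering the compact complement of [O]. *)
Lemma chain_bigcap_sub_open F O : compact [set: T] -> F !=set0 ->
  total_on F subset -> (forall B, F B -> closed B) -> open O ->
  \bigcap_(B in F) B `<=` O -> exists2 B, F B & B `<=` O.
Proof.
move=> cT [B0 FB0] totF clF oO FO.
have [||||_ [B FB <-] OB] := @compact_chain_cover (~` O) [set ~` B | B in F].
- by apply: subclosed_compact cT _ => //; exact: open_closedC.
- by exists (~` B0), B0.
- move=> _ _ [B FB <-] [C FC <-].
  by have [BC|CB] := totF _ _ FB FC; [right|left]; exact: subsetC.
- move=> x Ox; have /existsNP[B /not_implyP[FB Bx]] := contra_not (FO x) Ox.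
  exists (~` B); first by exists B.
  by apply: open_nbhs_nbhs; split; [apply: closed_openC; exact: clF|exact: Bx].
- by exists B => //; rewrite -(setCK B) -(setCK O); exact: subsetC.
Qed.

(** By normality, a non-empty clopen part [B] of the intersection [Q] and its complement in [Q] lie
    in disjoint open sets. Some member [C] already lies in their union; being connected and meeting
    the first, it stays there, and so does [Q]. *)
Lemma chain_bigcap_connected F : hausdorff_space T -> compact [set: T] ->
  F !=set0 -> total_on F subset ->
  (forall B, F B -> closed B) -> (forall B, F B -> connected B) ->
  connected (\bigcap_(B in F) B).
Proof.
move=> hT cT F0 totF clF conF; set Q := \bigcap_(B in F) B.
have clQ : closed Q by apply: closed_bigI.
move=> B [b Bb] [ O oO BO] [D cD BD].
have clB : closed B by rewrite BD; exact: closedI.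
(* This open set meets [Q] exactly in [B], so points of [Q] in the closure of the [V] below belong
   to [B]. *)
have BQO : set_nbhs B (~` Q `|` O).
  move=> x Bx; apply: open_nbhs_nbhs; split.
    by apply: openU => //; exact: closed_openC.
  by move: Bx; rewrite BO => -[_ Ox]; right.
have [V BV VO] := compact_normal hT cT clB BQO.
have [C FC CV] : exists2 C, F C & C `<=` V° `|` ~` closure V.
  apply: chain_bigcap_sub_open => //.
    by apply: openU; [exact: open_interior|exact/closed_openC/closed_closure].
  move=> x Qx; have [Ox|Ox] := pselect (O x).
    by left; apply: BV; rewrite BO.
  by right => /VO[].
have sepV : separated V° (~` closure V).
  split; apply/seteqP; split => // x [].
    by move=> /(closureS (@interior_subset _ V)).
  move=> Vx /(_ V°) [|y [/= nVy /interior_subset/subset_closure//]].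
  by apply: open_nbhs_nbhs; split => //; exact: open_interior.
have CsubV : C `<=` V°.
  have [//|CnV] := connected_subset sepV CV (conF _ FC).
  have Cb : C b by move: Bb; rewrite BO => -[Qb _]; exact: Qb.
  by case: (CnV b Cb); exact: subset_closure (interior_subset (BV b Bb)).
apply/seteqP; split; first by rewrite BO => x [].
move=> x Qx; rewrite BO; split => //.
by have [] := VO x (subset_closure (interior_subset (CsubV _ (Qx _ FC)))).
Qed.

End compact_chains.

(** * Selection of sequences and Hausdorff convergence *)

Section metric_lemmas.
Context {R : realType} {X : metricType R}.

(** A point of [Q n] whose distance to [y] is within [1/(n+1)] of the infimum serves every [e] at
    once. *)
Lemma cvg_selection (Q : nat -> set X) (y : X) :
  (forall n, Q n !=set0) ->
  (forall e, 0 < e -> \forall n \near \oo, exists2 x, Q n x & ball y e x) ->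
  exists2 x_ : nat -> X, x_ @ \oo --> y & forall n, Q n (x_ n).
Proof.
move=> Q0 Qy; pose D n := [set mdist y x | x in Q n].
have D0 n : has_inf (D n).
  split; first by have [x Qx] := Q0 n; exists (mdist y x), x.
  by exists 0 => _ [x _ <-]; exact: mdist_ge0.
have pick n : exists x, Q n x /\ mdist y x < inf (D n) + n.+1%:R^-1.
  have [//|_ [x Qx <-] xlt] := @inf_adherent _ (D n) n.+1%:R^-1 _ (D0 n).
  by exists x.
have [x_ x_P] := choice pick; exists x_; last by move=> n; have [] := x_P n.
apply/cvgrPdist_lt => e e0; have e20 : 0 < e / 2 by rewrite divr_gt0.
have := near_infty_natSinv_lt (PosNum e20); have := Qy _ e20.
apply: filterS2 => n [x Qx]; rewrite ballEmdist => /= yx nlt.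
have [_ /lt_trans->//] := x_P n; rewrite [e]splitr ltrD//.
apply: le_lt_trans yx; apply: ge_inf; last by exists x.
by have [] := D0 n.
Qed.

Lemma sub_thickening_closed (A B : set X) : closed B ->
  (forall e, 0 < e -> A `<=` thickening B e) -> A `<=` B.
Proof.
move=> clB AB x Ax; apply: clB => U /nbhs_ballP[e e0 xU].
by have [y By /ball_sym yx] := AB e e0 x Ax; exists y; split => //; exact: xU.
Qed.

Lemma hausdorff_radiiD (A B C : set X) e : hausdorff_radii A B (e / 2) ->
  hausdorff_radii B C (e / 2) -> hausdorff_radii A C e.
Proof.
move=> [e0 AB BA] [_ BC CB]; rewrite [e]splitr.
by split; [exact: addr_gt0|exact: thickeningD BC|exact: thickeningD BA].
Qed.

Lemma hausdorff_radiiU (A B A' B' : set X) e : hausdorff_radii A A' e ->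
  hausdorff_radii B B' e -> hausdorff_radii (A `|` B) (A' `|` B') e.
Proof.
move=> [e0 AA' A'A] [_ BB' B'B]; split=> // x [].
- by move=> /AA'[y]; exists y => //; left.
- by move=> /BB'[y]; exists y => //; right.
- by move=> /A'A[y]; exists y => //; left.
- by move=> /B'B[y]; exists y => //; right.
Qed.

Lemma hausdorff_radii1 (x y : X) e : 0 < e -> ball x e y ->
  hausdorff_radii [set x] [set y] e.
Proof.
by move=> e0 xy; split => // _ ->; [exists y => //; exact: ball_sym|exists x].
Qed.

Lemma ball_hyperspace (A B : hyperspace X) e : ball A e B ->
  hausdorff_radii A B e.
Proof.
by rewrite ballEmdist; exact/hausdorff_dist_lt/hyperspaceP/hyperspaceP.
Qed.

(** The halving yields a strict inequality: a radius bounds the infimum only weakly. *)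
Lemma hausdorff_radii_ball (A B : hyperspace X) e :
  hausdorff_radii A B (e / 2) -> ball A e B.
Proof.
move=> ABe; have [e20 _ _] := ABe; rewrite ballEmdist /=.
by apply: le_lt_trans (hausdorff_dist_le ABe) _; rewrite [ltRHS]splitr ltrDl.
Qed.

Lemma hyperspace_cvgP (A_ : nat -> hyperspace X) (A : hyperspace X) :
  A_ @ \oo --> A <->
  forall e, 0 < e -> \forall n \near \oo, hausdorff_radii (A_ n) A e.
Proof.
split=> [/cvg_ballP cA e /cA|cA].
  by apply: filterS => n /ball_sym; exact: ball_hyperspace.
apply/cvg_ballP => e e0; have /cA : 0 < e / 2 by rewrite divr_gt0.
by apply: filterS => n ?; apply/ball_sym/hausdorff_radii_ball.
Qed.

Lemma closed_subcontinuum (A : set X) : subcontinuum A -> closed A.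
Proof.
by move=> [_ cA _]; apply: compact_closed => //; exact: metric_hausdorff.
Qed.

Lemma subcontinuum1 (x : X) : subcontinuum [set x].
Proof. by split; [exists x|exact: compact_set1|exact: connected1]. Qed.

Lemma subcontinuumU (A B : set X) : subcontinuum A -> subcontinuum B ->
  A `&` B !=set0 -> subcontinuum (A `|` B).
Proof.
move=> [[x Ax] cA nA] [_ cB nB] AB; split; first by exists x; left.
  exact: compactU.
exact: connectedU.
Qed.

Lemma subcontinuum_ball_ex (A B : set X) e x : hausdorff_radii A B e ->
  B x -> exists2 y, A y & ball x e y.
Proof. by move=> [_ _ BA] /BA[y Ay yx]; exists y => //; exact: ball_sym. Qed.

End metric_lemmas.

(** * Irreducible subcontinua and maximal limit continua *)

Section continua.
Context {R : realType} {X : metricType R} (cX : compact [set: X]).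

Lemma chain_bigcap_subcontinuum (F : set (set X)) : F !=set0 ->
  total_on F subset -> (forall A, F A -> subcontinuum A) ->
  \bigcap_(A in F) A !=set0 -> subcontinuum (\bigcap_(A in F) A).
Proof.
move=> F0 totF subF cap0.
have clF A : F A -> closed A by move=> /subF/closed_subcontinuum.
split => //; first by apply: subclosed_compact cX _ => //; exact: closed_bigI.
apply: chain_bigcap_connected => //; first exact: metric_hausdorff.
by move=> A /subF[].
Qed.

Lemma chain_bigcup_subcontinuum (F : set (set X)) (a : X) : F !=set0 ->
  (forall A, F A -> subcontinuum A) -> (forall A, F A -> A a) ->
  subcontinuum (closure (\bigcup_(A in F) A)).
Proof.
move=> [A0 FA0] subF Fa; split.
- by exists a; apply: subset_closure; exists A0 => //; exact: Fa.
- by apply: subclosed_compact cX _ => //; exact: closed_closure.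
- apply/connected_closure/bigcup_connected; first by exists a => A /Fa.
  by move=> A /subF[].
Qed.

(** Zorn's lemma for reverse inclusion: the intersection of a chain is a continuum that still
    contains [a] and [b]. *)
Lemma exists_irreducible (K : hyperspace X) (a b : X) :
  (K : set X) a -> (K : set X) b ->
  exists2 I : hyperspace X, I `<=` K & irreducible_between I a b.
Proof.
move=> Ka Kb; pose P A := [/\ subcontinuum A, A `<=` K, A a & A b].
have [||||I [cI IK Ia Ib] minI] := @Zorn_in _ (fun A B => B `<=` A) P.
- by move=> A x.
- by move=> A B C BA CB; exact: subset_trans CB BA.
- by exists K; split => //; exact: hyperspaceP.
- move=> F [B FB] FP totF; exists (\bigcap_(A in F) A); last first.
    by move=> A FA; exact: bigcap_inf.
  have capa : (\bigcap_(A in F) A) a by move=> A /FP[].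
  have capb : (\bigcap_(A in F) A) b by move=> A /FP[].
  have [_ BK _ _] := FP _ FB.
  split => //; last by move=> x /(_ _ FB); exact: BK.
  apply: chain_bigcap_subcontinuum => //; first by exists B.
  + by move=> C D FC FD; have [|] := totF _ _ FC FD; [right|left].
  + by move=> A /FP[].
  + by exists a.
exists (Hyperspace cI) => //; split => // -[J [[JI IJ] Ja Jb]]; apply: IJ.
apply: minI => //; split => //; first exact: hyperspaceP.
exact: subset_trans IK.
Qed.

(** A sequence-free form of: [L] is the Hausdorff limit of continua through points of [S] that tend
    to [a]. *)
Definition limit_through (S : set X) (a : X) (L : set X) :=
  forall e, 0 < e -> exists x (A : hyperspace X),
    [/\ S x, ball a e x, (A : set X) x & hausdorff_radii A L e].

Lemma limit_through_mem S a L : closed L -> limit_through S a L -> L a.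
Proof.
move=> clL lL; apply: (@sub_thickening_closed _ _ [set a]) => // e e0 _ ->.
have /lL[x [A [_ ax Ax [_ AL _]]]] : 0 < e / 2 by rewrite divr_gt0.
have [y Ly yx] := AL x Ax; exists y => //.
exact: ball_splitl yx ax.
Qed.

(** By compactness the [e / 2]-thickening of a single member [L] covers the closure of the union, so
    continua close to [L] are close to that closure. *)
Lemma limit_through_chain S a (F : set (set X)) : F !=set0 ->
  total_on F subset -> (forall L, F L -> limit_through S a L) ->
  limit_through S a (closure (\bigcup_(L in F) L)).
Proof.
move=> [L0 FL0] totF lF e e0; set U := closure _.
have e20 : 0 < e / 2 by rewrite divr_gt0.
have [||||_ [L FL <-] UL] :=
  @compact_chain_cover _ U [set thickening L (e / 2) | L in F].
- by apply: subclosed_compact cX _ => //; exact: closed_closure.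
- by exists (thickening L0 (e / 2)), L0.
- move=> _ _ [L FL <-] [M FM <-]; have [LM|ML] := totF _ _ FL FM.
    by left => x [y Ly yx]; exists y => //; exact: LM.
  by right => x [y My yx]; exists y => //; exact: ML.
(* One quarter of [e] leads from [x] to a point of some [L]; the other leaves room for a
   neighbourhood of [x]. *)
- have e40 : 0 < e / 2 / 2 by rewrite divr_gt0.
  move=> x /(_ _ (nbhsx_ballx x _ e40))[y [[L FL Ly] xy]].
  exists (thickening L (e / 2)); first by exists L.
  apply: filterS (nbhsx_ballx x _ e40) => z xz.
  by exists y => //; exact: ball_splitr xy xz.
have [x [A [Sx ax Ax AL]]] := lF _ FL _ e20.
exists x, A; split => //.
  by apply: le_ball ax; rewrite ler_pdivrMr// ler_peMr ?ler1n ?ltW.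
apply: hausdorff_radiiD AL _; split => // y Ly.
by exists y; [apply: subset_closure; exists L|exact: ballxx].
Qed.

Lemma exists_maximal_limit_through (S : set X) (I : hyperspace X) (a : X) :
  closure S a -> (I : set X) a ->
  exists2 L, maximal_limit_continuum I L & limit_through S a L.
Proof.
move=> Sa Ia.
pose P L := [/\ subcontinuum L, L `<=` I & limit_through S a L].
have [||||L [cL LI lL] maxL] := @Zorn_in _ subset P.
- by move=> A x.
- by move=> A B C; exact: subset_trans.
(* Zorn's lemma starts from the point [a], approximated by one-point continua in [S]. *)
- exists [set a]; split; [exact: subcontinuum1|by move=> _ ->|move=> e e0].
  have [x [Sx ax]] := Sa _ (nbhsx_ballx a _ e0).
  exists x, (Hyperspace (subcontinuum1 x)); split => //=.
  exact/hausdorff_radii1/ball_sym.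
- move=> F F0 FP totF; exists (closure (\bigcup_(L in F) L)); last first.
    move=> L FL; apply: subset_trans (@subset_closure _ _).
    exact: bigcup_sup.
  split.
  + apply: (@chain_bigcup_subcontinuum _ a) => // A /FP[cA _ lA] //.
    by apply: limit_through_mem lA; exact: closed_subcontinuum.
  + have /closure_id -> := closed_subcontinuum (hyperspaceP I).
    by apply: closureS => x [A /FP[_ AI _] /AI].
  + by apply: limit_through_chain => // A /FP[].
exists (Hyperspace cL) => //; split => //.
have pick n : exists (A : hyperspace X) x,
    [/\ S x, ball a n.+1%:R^-1 x, (A : set X) x &
        hausdorff_radii A L n.+1%:R^-1].
  by have [//|x [A ?]] := lL n.+1%:R^-1; exists A, x.
have [A_ A_P] := choice pick; exists A_.
  apply/hyperspace_cvgP => e e0.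
  have := near_infty_natSinv_lt (PosNum e0); apply: filterS => n /= /ltW ne.
  have [x [_ _ _ [_ AL LA]]] := A_P n; split => // y.
    by move=> /AL[z Lz zy]; exists z => //; exact: le_ball zy.
  by move=> /LA[z Az zy]; exists z => //; exact: le_ball zy.
(* Each [N_ n] passes through the same point of [S] as [A_ n], so [N] satisfies [P] too; as [N]
   contains [L], Zorn maximality gives equality. *)
move=> N_ N AN /hyperspace_cvgP cN NI; apply: hyperspace_inj => /=.
have LN : L `<=` N.
  apply: sub_thickening_closed (closed_subcontinuum (hyperspaceP N)) _ => e e0.
  have e20 : 0 < e / 2 by rewrite divr_gt0.
  have [n [/ltW ne [_ NnN _]]] :=
    filter_ex (filterI (near_infty_natSinv_lt (PosNum e20)) (cN _ e20)).
  have [x [_ _ _ [_ _ LA]]] := A_P n; rewrite [e]splitr.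
  apply: (@thickeningD _ _ _ (N_ n)) => // y /LA[z Az zy].
  by exists z; [exact: AN|exact: le_ball zy].
apply/seteqP; split=> //; apply: maxL => //.
split => //; first exact: hyperspaceP.
move=> e e0.
have [n [/= /ltW ne NnN]] :=
  filter_ex (filterI (near_infty_natSinv_lt (PosNum e0)) (cN _ e0)).
have [x [Sx ax Ax _]] := A_P n.
by exists x, (N_ n); split => //; [exact: le_ball ax|exact: AN].
Qed.

(** * Maximal limit continua and approximation through prescribed points *)

Lemma maximal_limit_absorbs (K L I : hyperspace X) (a : X) :
  maximal_limit_continuum K L -> I `<=` K -> (L : set X) a -> (I : set X) a ->
  (forall a_ : nat -> X, a_ @ \oo --> a ->
    exists2 A_ : nat -> hyperspace X, A_ @ \oo --> I &
      forall n, (A_ n : set X) (a_ n)) ->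
  I `<=` L.
Proof.
move=> [LK [L_ /hyperspace_cvgP cL maxL]] IK La Ia appr.
have [||a_ cva L_a] := @cvg_selection _ _ (fun n => L_ n : set X) a.
- by move=> n; have [] := hyperspaceP (L_ n).
- move=> e /cL; apply: filterS => n /= LnL.
  exact: subcontinuum_ball_ex LnL La.
have [A_ /hyperspace_cvgP cA A_a] := appr _ cva.
have cLA n : subcontinuum (L_ n `|` A_ n).
  apply: subcontinuumU; [exact: hyperspaceP|exact: hyperspaceP|].
  by exists (a_ n).
have cLI : subcontinuum (L `|` I).
  by apply: subcontinuumU; [exact: hyperspaceP|exact: hyperspaceP|exists a].
suff /(congr1 (@hyperspace_set _ _)) /= <- : Hyperspace cLI = L.
  by move=> x; right.
apply: (maxL (fun n => Hyperspace (cLA n))).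
- by move=> n x; left.
- apply/hyperspace_cvgP => e e0; apply: filterS2 (cL _ e0) (cA _ e0) => n.
  exact: hausdorff_radiiU.
- by rewrite subUset.
Qed.

(** By contraposition: if for no [e] the bad points accumulate at [a], a sequence tending to [a]
    eventually avoids them for each [e], and [cvg_selection] in the hyperspace chooses the
    continua. *)
Lemma not_approximable (I : hyperspace X) (a : X) :
  ~ (forall a_ : nat -> X, a_ @ \oo --> a ->
    exists2 A_ : nat -> hyperspace X, A_ @ \oo --> I &
      forall n, (A_ n : set X) (a_ n)) ->
  exists2 e, 0 < e & closure [set x | forall A : hyperspace X,
    (A : set X) x -> ~ hausdorff_radii A I e] a.
Proof.
apply: contra_notP => /forall2NP far a_ cva.
apply: (@cvg_selection _ _
  (fun n => [set A : hyperspace X | (A : set X) (a_ n)])).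
  (* A candidate is required at every index, even where no continuum through [a_ n] is near [I]. *)
  by move=> n; exists (Hyperspace (subcontinuum1 (a_ n))).
move=> e e0; have e20 : 0 < e / 2 by rewrite divr_gt0.
have [//|ncl] := far (e / 2).
(* [a] is interior to the set of good points, which [a_] therefore eventually enters. *)
move: (ncl : (~` closure _) a); rewrite -interiorC.
move=> /cva; rewrite nbhs_filterE /=; apply: filterS => n /=.
move=> /existsNP[A /not_implyP[Aa /contrapT AI]].
by exists A => //; apply/ball_sym/hausdorff_radii_ball.
Qed.

Lemma exists_proper_maximal_limit (I : hyperspace X) (a : X) :
  (I : set X) a ->
  ~ (forall a_ : nat -> X, a_ @ \oo --> a ->
    exists2 A_ : nat -> hyperspace X, A_ @ \oo --> I &
      forall n, (A_ n : set X) (a_ n)) ->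
  exists L : hyperspace X,
    [/\ maximal_limit_continuum I L, (L : set X) a & ~ I `<=` L].
Proof.
move=> Ia /not_approximable[e e0 Sa].
have [L mL lL] := exists_maximal_limit_through Sa Ia; exists L; split => //.
  by apply: limit_through_mem lL; exact: closed_subcontinuum (hyperspaceP L).
(* If [L] were [I], a continuum through a bad point would be [e]-close to [I]. *)
have [LI _] := mL; move=> IL; have [x [A [far _ Ax AL]]] := lL _ e0.
apply: (far A Ax).
by have -> : I = L :> set X by exact/seteqP.
Qed.

End continua.

Theorem theorem2p2 (R : realType) (X : metricType R) (hX : continuum X) :
  semi_Kelley X <->
  forall (a b : X) (I : hyperspace X), irreducible_between I a b ->
    (forall a_ : nat -> X, a_ @ \oo --> a ->
       exists2 A_ : nat -> hyperspace X, A_ @ \oo --> I & forall n, (A_ n : set X) (a_ n)) \/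
    (forall b_ : nat -> X, b_ @ \oo --> b ->
       exists2 B_ : nat -> hyperspace X, B_ @ \oo --> I & forall n, (B_ n : set X) (b_ n)).
Proof.
have [cX _ _] := hX; split=> [sK a b I [Ia Ib irr]|irr K L M mL mM].
  apply: contrapT => /not_orP[nota notb].
  have [L [mL La IL]] := exists_proper_maximal_limit cX Ia nota.
  have [M [mM Mb IM]] := exists_proper_maximal_limit cX Ib notb.
  have [LM|ML] := sK I L M mL mM; apply: irr.
    (* [IM] is what makes [M] a proper subcontinuum of [I]. *)
    by exists M; split => //; [split => //; case: mM|exact: LM].
  by exists L; split => //; [split => //; case: mL|exact: ML].
apply: contrapT => /not_orP[/existsNP[a /not_implyP[La nMa]]].
move=> /existsNP[b /not_implyP[Mb nLb]].
have [[LK _] [MK _]] := (mL, mM).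
have [I IK irrI] := exists_irreducible cX (LK _ La) (MK _ Mb).
have [Ia Ib _] := irrI.
have [appr|appr] := irr a b I irrI.
  by apply: nLb; exact: (maximal_limit_absorbs mL IK La Ia appr).
by apply: nMa; exact: (maximal_limit_absorbs mM IK Mb Ib appr).
Qed.
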